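(* Let $n$ be a positive integer and let $P_n = 2^{n-1}(2^n-1)$. If $n\equiv 1 \pmod 3$ or $n\equiv 2\pmod 6$, then the Diophantine equation $$P_n = x^3+y^3+z^3$$ has at least one solution in integers $x,y,z$. Moreover, if $n\equiv \pm 1\pmod 6$, then this equation has at least two solutions in integers $x,y,z$.
   Context: Integers $x,y,z$ may be negative or zero. Solutions $(x,y,z)$ that differ only by a permutation of the coordinates are regarded as the same solution, so ''at least two solutions'' means at least two distinct multisets $\{x,y,z\}$ of integers. *)

(* Defs.v *)
From mathcomp Require Import all_boot all_order all_algebra.

Set Implicit Arguments.
Unset Strict Implicit.
Unset Printing Implicit Defensive.

Import GRing.Theory.
Local Open Scope ring_scope.

(* The predecessor n.-1 is truncated; P 0 is a junk value. *)
Definition P (n : nat) : int := 2 ^+ n.-1 * (2 ^+ n - 1).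

Definition sum_of_cubes (m x y z : int) : Prop := m = x ^+ 3 + y ^+ 3 + z ^+ 3.

(* Two triples are the same solution when they agree up to a permutation of
   the coordinates, i.e. when they have the same underlying multiset. *)
Definition same_solution (x y z x' y' z' : int) : bool :=
  perm_eq [:: x; y; z] [:: x'; y'; z'].

(* Main.v *)
Require Import Defs.
From mathcomp Require Import all_boot all_order all_algebra.
From mathcomp Require Import ring zify.

Import GRing.Theory Num.Theory.
Local Open Scope ring_scope.

(** Since [P n = 2 ^ (2 n - 1) - 2 ^ (n - 1)], put [a = 2 ^ k].  Then
    [P (3 k + 1) = 2 a ^ 6 - a ^ 3] and [P (3 k + 2) = (2 a ^ 2) ^ 3 - 2 a ^ 3],
    and both right-hand sides are visibly sums of three cubes.

    When [n] is coprime to 6, a second solution comes from the identity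
    [(b ^ 2 + b - 1) ^ 3 + (b ^ 2 - b - 1) ^ 3 = 2 b ^ 6 - 2]
    ([add_cubes_quadratic]).  If [n = 6 q + 1], take [a = 2 ^ (2 q)] and
    [b = 2 ^ q]: then [P n = a ^ 3 (2 b ^ 6 - 1)], where
    [2 b ^ 6 - 1 = (2 b ^ 6 - 2) + 1 ^ 3].  If [n = 6 q + 5], take
    [a = 2 ^ (2 q + 1)] and [b = 2 ^ (q + 1)]: then [P n = a ^ 3 (b ^ 6 - 2)],
    where [b ^ 6 - 2 = (2 b ^ 6 - 2) - (b ^ 2) ^ 3] and [b ^ 2 = 2 a].
    The second solution differs from the first because its third coordinate
    does not occur in the first one, except when [n = 1]: there the two
    coincide, and [1 = 1 ^ 3 + 0 ^ 3 + 0 ^ 3] is used instead. *)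

Lemma P_mul3_add1 k : P (3 * k).+1 = 2 * (2 ^+ k) ^+ 6 - (2 ^+ k) ^+ 3.
Proof. by rewrite /P /= exprS mulnC exprM; ring. Qed.

Lemma P_mul3_add2 k : P (3 * k).+2 = 8 * (2 ^+ k) ^+ 6 - 2 * (2 ^+ k) ^+ 3.
Proof. by rewrite /P /= !exprS mulnC exprM; ring. Qed.

Lemma sum_of_cubes_mul3_add1 k (a := 2 ^+ k) :
  sum_of_cubes (P (3 * k).+1) (a ^+ 2) (a ^+ 2) (- a).
Proof. by rewrite /sum_of_cubes P_mul3_add1 -/a; ring. Qed.

Lemma sum_of_cubes_mul3_add2 k (a := 2 ^+ k) :
  sum_of_cubes (P (3 * k).+2) (2 * a ^+ 2) (- a) (- a).
Proof. by rewrite /sum_of_cubes P_mul3_add2 -/a; ring. Qed.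

(** The sum of the two cubes is [2 u ^ 3 + 6 u b ^ 2] with [u = b ^ 2 - 1], and
    the middle terms [- 6 b ^ 4 + 6 b ^ 2] of [2 u ^ 3] cancel [6 u b ^ 2]. *)
Lemma add_cubes_quadratic (R : comPzRingType) (b : R) :
  (b ^+ 2 + b - 1) ^+ 3 + (b ^+ 2 - b - 1) ^+ 3 = 2 * b ^+ 6 - 2.
Proof. by ring. Qed.

Lemma sum_of_cubes_mul6_add1 q (a := 2 ^+ (2 * q)) (b := 2 ^+ q) :
  sum_of_cubes (P (3 * (2 * q)).+1) (a * (a + b - 1)) (a * (a - b - 1)) a.
Proof.
have aE : a = b ^+ 2 by rewrite /a mulnC exprM.
rewrite /sum_of_cubes P_mul3_add1 -/a !(exprMn _ a) -mulrDr.
by rewrite aE add_cubes_quadratic; ring.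
Qed.

Lemma sum_of_cubes_mul6_add5 q (a := 2 ^+ (2 * q).+1) (b := 2 ^+ q.+1) :
  sum_of_cubes (P (3 * (2 * q).+1).+2)
    (a * (2 * a + b - 1)) (a * (2 * a - b - 1)) (- (2 * a ^+ 2)).
Proof.
have aE : 2 * a = b ^+ 2 by rewrite /a /b !exprS mulnC exprM; ring.
rewrite /sum_of_cubes P_mul3_add2 -/a !(exprMn _ a) -mulrDr.
rewrite aE add_cubes_quadratic.
have -> : b ^+ 6 = (2 * a) ^+ 3 by rewrite aE -exprM.
by ring.
Qed.

(** One coordinate suffices to separate two solutions, which avoids comparing
    all six permutations. *)
Lemma notin_not_same_solution (x y z x' y' z' : int) :
  z' \notin [:: x; y; z] -> ~~ same_solution x y z x' y' z'.
Proof.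
by apply: contra => /perm_mem /(_ z') ->; rewrite !inE eqxx !orbT.
Qed.

Theorem theorem2p1 (n : nat) (n_gt0 : (0 < n)%N) :
  ((n = 1 %[mod 3])%N \/ (n = 2 %[mod 6])%N ->
     exists x y z : int, sum_of_cubes (P n) x y z)
  /\
  ((n = 1 %[mod 6])%N \/ (n = 5 %[mod 6])%N ->
     exists x y z x' y' z' : int,
       [/\ sum_of_cubes (P n) x y z,
           sum_of_cubes (P n) x' y' z' &
           ~~ same_solution x y z x' y' z']).
Proof.
split=> [[n1 | n2] | [n1 | n5]].
- have -> : n = (3 * (n %/ 3)).+1 by lia.
  by do 3 eexists; exact: sum_of_cubes_mul3_add1.
- have -> : n = (3 * (n %/ 3)).+2 by lia.
  by do 3 eexists; exact: sum_of_cubes_mul3_add2.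
- have -> : n = (3 * (2 * (n %/ 6))).+1 by lia.
  (* For n = 1 the general second solution is 1, -1, 1, the first one again. *)
  case: (n %/ 6)%N => [|q]; first by exists 1, 1, (-1), 1, 0, 0.
  do 6 eexists; split.
  + exact: sum_of_cubes_mul3_add1.
  + exact: sum_of_cubes_mul6_add1.
  + apply: notin_not_same_solution; rewrite !inE.
    have : 1 < 2 ^+ (2 * q.+1) :> int by rewrite exprn_egt1.
    by move: (2 ^+ _) => a; nia.
- have -> : n = (3 * (2 * (n %/ 6)).+1).+2 by lia.
  do 6 eexists; split.
  + exact: sum_of_cubes_mul3_add2.
  + exact: sum_of_cubes_mul6_add5.
  + apply: notin_not_same_solution; rewrite !inE.
    have : 0 < 2 ^+ (2 * (n %/ 6)).+1 :> int by rewrite exprn_gt0.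
    by move: (2 ^+ _) => a; nia.
Qed.
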